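(* Let $q$ be a prime power and let $n\ge 1$ and $0\le k\le n$ be integers. The number of nilpotent $n\times n$ matrices of rank $n-k$ with entries in the finite field $F_q$ is \[ \frac{|GL(n,q)|}{|GL(k,q)|}\cdot \frac{\big(1-\frac{1}{q^k}\big)\big(1-\frac{1}{q^{k+1}}\big)\cdots \big(1-\frac{1}{q^{n-1}}\big)}{q^{n-k} \big(1-\frac{1}{q}\big)\big(1-\frac{1}{q^2}\big) \cdots \big(1-\frac{1}{q^{n-k}}\big)}. \]
   Context: $F_q$ is the field with $q$ elements and $|GL(m,q)|=\prod_{i=0}^{m-1}(q^m-q^i)$ is the order of the group of invertible $m\times m$ matrices over $F_q$ (with $|GL(0,q)|=1$). When $k=n$ the products $(1-\frac{1}{q^k})\cdots(1-\frac1{q^{n-1}})$ and $(1-\frac1q)\cdots(1-\frac{1}{q^{n-k}})$ are empty and equal $1$. *)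

(* Defs.v *)
From HB Require Import structures.
From mathcomp Require Import all_boot all_order all_algebra.
From mathcomp Require Import boolp.

Set Implicit Arguments.
Unset Strict Implicit.
Unset Printing Implicit Defensive.

Import Order.TTheory GRing.Theory Num.Theory.

Local Open Scope ring_scope.

Definition nilpotent_mx (F : fieldType) (n : nat) (A : 'M[F]_n) : Prop :=
  exists m : nat, A ^+ m = 0.

Definition nilpotent_mx_of_rank (F : finFieldType) (n r : nat) :
    {set 'M[F]_n} :=
  [set A : 'M[F]_n | `[< nilpotent_mx A >] & \rank A == r].

(* The library's 'GL_m[F] consists of matrices of size m.-1.+1, so 'GL_0[F]   *)
(* is a copy of 'GL_1[F]. Counting units of 'M[F]_m gives the value 1 at      *)
(* m = 0, see orderGL0.                                                       *)
Definition orderGL (F : finFieldType) (m : nat) : nat :=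
  #|[set A : 'M[F]_m | A \in unitmx]|.

Lemma orderGL_prod (F : finFieldType) (m : nat) :
  orderGL F m = (\prod_(i < m) (#|F| ^ m - #|F| ^ i))%N.
Proof.
case: m => [|m].
  rewrite big_ord0 /orderGL (_ : [set A | _] = [set 0]) ?cards1 //.
  apply/setP=> A; rewrite !inE [A]flatmx0 eqxx.
  by rewrite unitmxE det_mx00 unitr1.
transitivity #|'GL_m.+1[F]%g|.
  rewrite /orderGL cardsT /= card_sub cardsE.
  by apply: eq_card => A; rewrite !inE.
rewrite card_GL // -bin2_sum expn_sum big_add1 /= [X in (_ * X)%N]big_nat_rev /=.
rewrite !big_mkord -big_split /=; apply: eq_bigr => i _.
have lei : (i <= m)%N by rewrite -ltnS.
by rewrite add0n subSS mulnBr muln1 -expnD addnS subnKC.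
Qed.

Lemma orderGL0 (F : finFieldType) : orderGL F 0 = 1%N.
Proof. by rewrite orderGL_prod big_ord0. Qed.

(* Main.v *)
(* Write M(n, r) for the number of nilpotent matrices of size n and rank r.
   Counting pairs (A, v) with v a nonzero row vector and v A = 0, and moving v
   to the first basis vector by conjugation, reduces to matrices with zero first
   row, i.e. a nilpotent B of size n - 1 bordered by an arbitrary column u. The
   rank is rank B or rank B + 1 according to whether u lies in the column space
   of B, so that
     (q^(n-r) - 1) M(n, r)
       = (q^n - 1) (q^r M(n-1, r) + (q^(n-1) - q^(r-1)) M(n-1, r-1)).
   With M(n, 0) = 1 and M(n, n) = 0 for n > 0, this determines M, and the
   product formula satisfies the same recurrence. *)
Require Import Defs.
From HB Require Import structures.
From mathcomp Require Import all_boot all_order all_algebra.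
From mathcomp Require Import boolp mxabelem ring.

Import Order.TTheory GRing.Theory Num.Theory.

Local Open Scope ring_scope.

(** * Nilpotency under bordering and conjugation *)

(** The exponent is a successor because the zeroth power is the identity, whose first row is
    nonzero. *)
Lemma expmx_block0 (F : fieldType) (n m : nat) (u : 'cV[F]_n) (B : 'M[F]_n) :
  (block_mx (0 : 'M_1) 0 u B : 'M_(1 + n)) ^+ m.+1 =
  block_mx 0 0 (B ^+ m *m u) (B ^+ m.+1).
Proof.
elim: m => [|m IHm]; first by rewrite !expr1 expr0 mul1mx.
rewrite exprS IHm -[RHS]/(block_mx _ _ _ _).
rewrite -[LHS]/(mulmx _ _) mulmx_block !mul0mx !mulmx0 !add0r.
by rewrite mulmxA !mulmxE -!exprS.
Qed.

Lemma nilpotent_block0 (F : fieldType) (n : nat) (u : 'cV[F]_n) (B : 'M[F]_n) :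
  nilpotent_mx (block_mx (0 : 'M_1) 0 u B : 'M_(1 + n)) <-> nilpotent_mx B.
Proof.
split=> [[m Am0]|[m Bm0]].
  exists m.+1; have : (block_mx (0 : 'M_1) 0 u B : 'M_(1 + n)) ^+ m.+1 = 0.
    by rewrite exprSr Am0 mul0r.
  rewrite expmx_block0 -[X in _ = X](@block_mx_const _ 1 n 1 n 0).
  by case/eq_block_mx.
exists m.+1; rewrite expmx_block0 exprS Bm0 mulr0 mul0mx.
exact: (@block_mx_const _ 1 n 1 n 0).
Qed.

Lemma nilpotent_conj (F : fieldType) (n : nat) (P A : 'M[F]_n) :
  P \in unitmx -> nilpotent_mx (P *m A *m invmx P) <-> nilpotent_mx A.
Proof.
move=> uP; have conjX m : (P *m A *m invmx P) ^+ m = P *m A ^+ m *m invmx P.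
  elim: m => [|m IHm]; first by rewrite !expr0 mulmx1 mulmxV.
  by rewrite !exprS IHm -!mulmxE !mulmxA mulmxKV.
split=> -[m Am0]; exists m; last by rewrite conjX Am0 mulmx0 mul0mx.
by rewrite -[A ^+ m](mulKmx uP) -[P *m _](mulmxKV uP) -conjX Am0 mul0mx mulmx0.
Qed.

(** * Rank after adjoining one vector *)

(** If [w] lies outside the row space of [C], the two spaces meet in a proper subspace of a line,
    that is, in 0, so the ranks add. *)
Lemma rank_col_rV (F : fieldType) (m n : nat) (w : 'rV[F]_n) (C : 'M_(m, n)) :
  \rank (col_mx w C) = (~~ (w <= C)%MS + \rank C)%N.
Proof.
rewrite -addsmxE; case: (boolP (w <= C)%MS) => [/addsmx_idPr -> // | nwC].
have wC0 : \rank (w :&: C)%MS = 0%N.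
  apply/eqP; rewrite -leqn0 -ltnS.
  apply: leq_trans (rank_leq_row w); apply: rank_ltmx.
  by rewrite ltmxE capmxSl sub_capmx submx_refl.
have w1 : \rank w = 1%N.
  by rewrite rank_rV; case: eqVneq nwC => // ->; rewrite sub0mx.
by have := mxrank_sum_cap w C; rewrite wC0 w1 addn0.
Qed.

(** After transposing, the vectors that keep the rank form the row space of [B^T]; all others raise
    it by one. *)
Lemma card_rank_row_cV (F : finFieldType) (n r : nat) (B : 'M[F]_n) :
  #|[set u : 'cV[F]_n | \rank (row_mx u B) == r]| =
  (if \rank B == r then #|F| ^ r else
   if (\rank B).+1 == r then #|F| ^ n - #|F| ^ \rank B else 0)%N.
Proof.
rewrite -(card_imset _ (@trmx_inj F n 1)).
have -> : trmx @: [set u : 'cV[F]_n | \rank (row_mx u B) == r] =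
    [set w : 'rV[F]_n | (~~ (w <= B^T)%MS + \rank B == r)%N].
  apply/setP=> w; apply/imsetP/idP => [[u]|]; rewrite !inE => hr.
    by move=> ->; rewrite -(mxrank_tr B) -rank_col_rV -tr_row_mx mxrank_tr.
  exists w^T; rewrite ?trmxK // inE -mxrank_tr tr_row_mx trmxK.
  by rewrite rank_col_rV mxrank_tr.
case: (eqVneq (\rank B) r) => [<-|neq_r].
  rewrite -[in RHS](mxrank_tr B) -card_rowg; apply: eq_card => w.
  by rewrite !inE; case: (w <= _)%MS; rewrite ?eqxx //= add1n gtn_eqF.
case: eqP => [<-|/eqP neq_r1].
  rewrite -[in RHS](mxrank_tr B) -card_rowg -[X in (_ ^ X - _)%N]mul1n -card_mx.
  rewrite -cardsT -cardsDS ?subsetT //; apply: eq_card => w.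
  by rewrite !inE; case: (w <= _)%MS; rewrite ?eqxx //= ?add0n ltn_eqF.
apply: eq_card0 => w; rewrite !inE; case: (w <= _)%MS => /=.
  exact: negbTE.
by rewrite add1n; apply: negbTE.
Qed.

(** * The recurrence, through matrices with zero first row *)

Definition nilpotent_row0 (F : finFieldType) (n r : nat) : {set 'M[F]_n.+1} :=
  [set A in nilpotent_mx_of_rank F n.+1 r | row ord0 A == 0].

(** Such a matrix is a nilpotent [B] bordered by a column [u], so the admissible [u] are counted for
    each [B]. *)
Lemma card_nilpotent_row0 (F : finFieldType) (n r : nat) :
  #|nilpotent_row0 F n r.+1| =
  (#|nilpotent_mx_of_rank F n r.+1| * #|F| ^ r.+1 +
   #|nilpotent_mx_of_rank F n r| * (#|F| ^ n - #|F| ^ r))%N.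
Proof.
pose g (x : 'M[F]_n * 'cV[F]_n) : 'M[F]_n.+1 := block_mx (0 : 'M_1) 0 x.2 x.1.
have g_inj : injective g.
  by move=> [B u] [B' u'] /(@eq_block_mx _ 1 n 1 n) [_ _ /= -> ->].
have rank_g B u : \rank (g (B, u)) = \rank (row_mx u B).
  by rewrite /g /= /block_mx row_mx0; apply: (@rank_col_0mx _ n (1 + n) 1).
have -> : nilpotent_row0 F n r.+1 =
    g @: [set x | `[< nilpotent_mx x.1 >] & \rank (row_mx x.2 x.1) == r.+1].
  apply/setP=> A; apply/idP/imsetP => [|[[B u]]]; rewrite !inE.
    case/andP=> /andP [nilA rA] /eqP A0.
    have defA : A = g (@drsubmx _ 1 n 1 n A, @dlsubmx _ 1 n 1 n A).
      have ul0 : @ulsubmx _ 1 n 1 n A = 0.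
        apply/matrixP=> i j; rewrite !mxE (ord1 i).
        have /rowP/(_ (lshift n j)) := A0; rewrite !mxE => <-.
        by congr (A _ _); apply: val_inj.
      have ur0 : @ursubmx _ 1 n 1 n A = 0.
        apply/matrixP=> i j; rewrite !mxE (ord1 i).
        have /rowP/(_ (rshift 1 j)) := A0; rewrite !mxE => <-.
        by congr (A _ _); apply: val_inj.
      by rewrite /g /= -[LHS](@submxK _ 1 n 1 n) ul0 ur0.
    eexists; last exact: defA.
    rewrite inE /= -rank_g -defA rA andbT; apply/asboolP.
    by move/asboolP: nilA; rewrite {1}defA => /nilpotent_block0.
  rewrite /= -rank_g => /andP [/asboolP nilB rg] ->; rewrite rg andbT.
  apply/andP; split; first by apply/asboolP/nilpotent_block0.
  apply/eqP/rowP=> j; rewrite /g /block_mx row_mx0 !mxE.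
  by case: splitP => [i _|i //]; rewrite mxE.
rewrite card_imset //.
rewrite -sum1_card (partition_big fst predT) //=.
pose w (B : 'M[F]_n) := #|[set u : 'cV[F]_n | \rank (row_mx u B) == r.+1]|.
transitivity (\sum_(B : 'M[F]_n | `[< nilpotent_mx B >]) w B)%N.
  rewrite [RHS]big_mkcond; apply: eq_bigr => B _.
  rewrite sum1dep_card; case: ifP => nilB; last first.
    apply: eq_card0 => -[B' u]; rewrite !inE /=.
    by case: (eqVneq B' B) => [->|_]; rewrite ?nilB ?andbF.
  have pair_inj : injective (fun u : 'cV[F]_n => (B, u)) by move=> u u' [].
  rewrite /w -(card_imset _ pair_inj).
  apply: eq_card => -[B' u]; apply/idP/imsetP; rewrite !inE /=.
    by case/andP=> /andP [_ ?] /eqP <-; exists u; rewrite ?inE.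
  by case=> u'; rewrite inE => ? [-> ->]; rewrite nilB eqxx andbT.
rewrite -!sum_nat_const [LHS]big_mkcond.
rewrite [X in (X + _)%N]big_mkcond [X in (_ + X)%N]big_mkcond /=.
rewrite -big_split /=; apply: eq_bigr => B _.
rewrite /w card_rank_row_cV !inE; case: asboolP => //= _.
(* The ranks r and r + 1 exclude each other, so at most one of the two terms survives for each
   [B]. *)
have [->|neq_r1] := eqVneq (\rank B) r.+1.
  by rewrite gtn_eqF // addn0.
by rewrite eqSS add0n; case: eqP => [->|].
Qed.

(** Conjugation by an invertible [P] with first row proportional to [v] preserves nilpotency and
    rank, and turns v A = 0 into a zero first row. *)
Lemma card_nilpotent_ker (F : finFieldType) (n r : nat) (v : 'rV[F]_n.+1) :
  v != 0 ->
  #|[set A in nilpotent_mx_of_rank F n.+1 r | v *m A == 0]| =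
  #|nilpotent_row0 F n r|.
Proof.
move=> nz_v.
(* Gaussian elimination of [v]: [row_ebase] gives [P], and the 1 by 1 unit [col_ebase] gives [c]. *)
have [c nz_c [P uP defv]] : exists2 c : F, c != 0 &
    exists2 P : 'M_n.+1, P \in unitmx & v = c *: (delta_mx 0 0 *m P).
  have uc := col_ebase_unit v.
  exists (col_ebase v 0 0).
    by move: uc; rewrite unitmxE det_mx11 unitfE.
  exists (row_ebase v); first exact: row_ebase_unit.
  rewrite -{1}(mulmx_ebase v) rank_rV nz_v -mulmxA.
  rewrite {1}[col_ebase v]mx11_scalar mul_scalar_mx; congr (_ *: (_ *m _)).
  by apply/rowP=> j; rewrite !mxE /= andbT eq_sym.
pose h (A : 'M[F]_n.+1) := P *m A *m invmx P.
have h_inj : injective h.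
  move=> A B /(congr1 (fun X => invmx P *m (X *m P))).
  by rewrite /h !mulmxKV // !mulKmx.
rewrite -(card_imset _ h_inj).
have hE A : (h A \in nilpotent_row0 F n r) =
    (A \in [set A in nilpotent_mx_of_rank F n.+1 r | v *m A == 0]).
  rewrite !inE; congr [&& _ && _ & _].
  - by apply/asboolP/asboolP => /nilpotent_conj; apply.
  - by rewrite /h mxrankMfree ?row_free_unit ?unitmx_inv // -mxrank_tr trmx_mul
      mxrankMfree ?row_free_unit ?unitmx_tr // mxrank_tr.
  rewrite rowE /h defv !mulmxA -scalemxAl scalemx_eq0 (negPf nz_c) /=.
  apply/eqP/eqP => [/(congr1 (mulmx^~ P))|->]; last by rewrite mul0mx.
  by rewrite mulmxKV // mul0mx.
apply: eq_card => A; apply/imsetP/idP => [[B]|Ain].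
  by rewrite -hE => ? ->.
exists (invmx P *m (A *m P)); last by rewrite /h mulKVmx // mulmxK.
by rewrite -hE /h mulKVmx // mulmxK.
Qed.

(* Both sides count the pairs (A, v) with v a nonzero vector killed by A. *)
Lemma card_nilpotent_rank_row0 (F : finFieldType) (n r : nat) :
  (#|nilpotent_mx_of_rank F n.+1 r| * (#|F| ^ (n.+1 - r)).-1 =
   (#|F| ^ n.+1).-1 * #|nilpotent_row0 F n r|)%N.
Proof.
pose N := nilpotent_mx_of_rank F n.+1 r.
transitivity (\sum_(A in N) \sum_(v : 'rV[F]_n.+1 | v != 0%R)
    if v *m A == 0%R then 1 else 0)%N.
  rewrite -sum_nat_const; apply: eq_bigr => A; rewrite inE => /andP [_ /eqP <-].
  (* The left kernel of [A] has dimension n + 1 - rank A; its zero vector is discarded. *)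
  rewrite -big_mkcondr sum1dep_card -mxrank_ker -card_rowg.
  rewrite (cardsD1 0) inE sub0mx; apply: eq_card => v.
  by rewrite !inE sub_kermx.
rewrite exchange_big /=.
transitivity (\sum_(v : 'rV[F]_n.+1 | v != 0%R) #|nilpotent_row0 F n r|)%N.
  apply: eq_bigr => v nz_v; rewrite -(@card_nilpotent_ker F n r v nz_v).
  by rewrite -big_mkcondr sum1dep_card.
rewrite sum_nat_const; congr (_ * _)%N.
rewrite -[X in (_ ^ X)%N]mul1n -card_mx -cardsT (cardsD1 0) inE.
by apply: eq_card => v; rewrite !inE andbT.
Qed.

(** * Boundary values *)

Lemma card_nilpotent_rank0 (F : finFieldType) (n : nat) :
  #|nilpotent_mx_of_rank F n 0| = 1%N.
Proof.
rewrite (_ : nilpotent_mx_of_rank F n 0 = [set 0]) ?cards1 //.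
apply/setP=> A; rewrite !inE mxrank_eq0; case: eqP => [->|]; rewrite ?andbF //.
by rewrite andbT; apply/asboolP; exists 1%N; rewrite expr1.
Qed.

(** Powers of an invertible matrix are invertible, and 0 is not invertible in positive size. *)
Lemma card_nilpotent_full_rank (F : finFieldType) (n : nat) :
  #|nilpotent_mx_of_rank F n.+1 n.+1| = 0%N.
Proof.
apply: eq_card0 => A; rewrite !inE; apply/negP => /andP [/asboolP [m Am0]].
rewrite -[_ == _]/(row_free A) row_free_unit => uA.
by have := unitrX m uA; rewrite Am0 unitr0.
Qed.

(** * The product formula and its recurrence *)

(* The q^-1-Pochhammer symbol (1/q; 1/q)_m. *)
Definition qfact (q : rat) (m : nat) : rat :=
  \prod_(1 <= i < m.+1) (1 - 1 / q ^+ i).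

Lemma qfactS (q : rat) (m : nat) :
  qfact q m.+1 = qfact q m * (1 - 1 / q ^+ m.+1).
Proof. by rewrite /qfact big_nat_recr. Qed.

Lemma qfact0 (q : rat) : qfact q 0 = 1.
Proof. by rewrite /qfact big_geq. Qed.

Lemma expr_neq1 (q : rat) (m : nat) : 1 < q -> q ^+ m.+1 - 1 != 0.
Proof. by move=> q1; rewrite subr_eq0 gt_eqF // exprn_egt1. Qed.

Lemma qfact_neq0 (q : rat) (m : nat) : 1 < q -> qfact q m != 0.
Proof.
move=> q1; elim: m => [|m IHm]; first by rewrite qfact0 oner_eq0.
rewrite qfactS mulf_neq0 // subr_eq0 eq_sym div1r invr_eq1.
by rewrite -subr_eq0 expr_neq1.
Qed.

(** Each factor q^m - q^i equals q^m (1 - 1/q^(m-i)); the index is then reversed. *)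
Lemma orderGL_qfact (F : finFieldType) (m : nat) :
  (orderGL F m)%:R = (#|F|%:R : rat) ^+ (m * m) * qfact #|F|%:R m.
Proof.
have q0 : (#|F|%:R : rat) != 0.
  by rewrite pnatr_eq0 -lt0n; apply: leq_trans (card_finNzRing_gt1 F).
rewrite orderGL_prod natr_prod exprM /qfact big_add1 /= big_mkord.
rewrite -[X in _ ^+ X]card_ord -prodr_const -big_split /=.
rewrite (reindex_inj rev_ord_inj) /=; apply: eq_bigr => i _.
rewrite natrB ?leq_pexp2l ?(leq_trans _ (card_finNzRing_gt1 F)) ?leq_subr //.
rewrite !natrX mulrBr mulr1 mul1r; congr (_ - _).
by rewrite -expfB_cond ?(negPf q0) ?ltn_ord.
Qed.

(** The target formula at n = j + r + 1, k = j + 1, with the powers of q collected. *)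
Definition nilpotent_count (q : rat) (j r : nat) : rat :=
  q ^+ (r * (r + j.*2.+1)) * qfact q (j + r).+1 * qfact q (j + r) /
  (qfact q j.+1 * qfact q j * qfact q r).

(** Induction on [r], then on [j]: the recurrence for (j, r + 1) involves (j, r) and (j - 1, r +
    1). *)
Lemma nilpotent_countE (F : finFieldType) (j r : nat) :
  #|nilpotent_mx_of_rank F (j + r).+1 r|%:R = nilpotent_count #|F|%:R j r.
Proof.
have q1 : (1 : rat) < #|F|%:R by rewrite ltr1n card_finNzRing_gt1.
have nz_qf m := qfact_neq0 _ m q1.
have q0 : (#|F|%:R : rat) != 0 by rewrite gt_eqF // (lt_trans ltr01).
have q_gt0 : (0 < #|F|)%N by apply: leq_trans (card_finNzRing_gt1 F).
have natr_pred m : (#|F| ^ m).-1%:R = (#|F|%:R : rat) ^+ m - 1.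
  by rewrite -subn1 natrB ?natrX // expn_gt0 q_gt0.
elim: r j => [|r IHr] j.
  rewrite addn0 card_nilpotent_rank0 /nilpotent_count addn0 qfact0 mul0n expr0.
  by rewrite mul1r mulr1 divff // mulf_neq0.
(* The premise is the formula for the pair (i - 1, r + 1), rewritten so that it
   still makes sense, as 0, at i = 0. *)
have step i : #|nilpotent_mx_of_rank F (i + r).+1 r.+1|%:R =
    (#|F|%:R : rat) ^+ (r.+1 * (r + i.*2)) * qfact #|F|%:R (i + r).+1 *
      qfact #|F|%:R (i + r) * (1 - 1 / #|F|%:R ^+ i) /
      (qfact #|F|%:R i ^+ 2 * qfact #|F|%:R r.+1) ->
    #|nilpotent_mx_of_rank F (i + r).+2 r.+1|%:R =
    nilpotent_count #|F|%:R i r.+1.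
  (* Size minus rank is i + 1, so the recurrence carries the nonzero factor q^(i+1) - 1. *)
  move=> IH; apply: (mulIf (expr_neq1 _ i q1)).
  have := congr1 (fun m : nat => m%:R : rat)
    (card_nilpotent_rank_row0 F (i + r).+1 r.+1).
  rewrite card_nilpotent_row0 !subSS -addSn addnK !natrM natrD !natrM.
  rewrite !natr_pred natrB ?leq_pexp2l ?(leqW (leq_addl _ _)) //.
  rewrite !natrX IH IHr => ->.
  rewrite /nilpotent_count.
  (* Both exponents are split over common summands, so that [field] sees the same powers on each
     side. *)
  have -> : (r.+1 * (r + i.*2) = r * (r + i.*2.+1) + i + i)%N.
    by rewrite -addnn; ring.
  have -> : (r.+1 * (r.+1 + i.*2.+1) = r * (r + i.*2.+1) + i + i + r + r + 2)%N.
    by rewrite -addnn; ring.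
  rewrite !addnS !qfactS.
  have nz_b := expr_neq1 _ i q1; have nz_c := expr_neq1 _ r q1.
  move: nz_b nz_c; rewrite !exprS !exprD => nz_b nz_c.
  by field; rewrite !nz_qf !expf_neq0 // q0 nz_b nz_c.
elim: j => [|j IHj]; rewrite addnS; apply: step.
  by rewrite card_nilpotent_full_rank divr1 subrr mulr0 mul0r.
(* The factor 1 - 1/q^(j+1) cancels against one of the two copies of [qfact] at j + 1, leaving
   [qfact] at j. *)
rewrite addSnnS IHj /nilpotent_count.
have -> : (r + j.+1.*2 = r.+1 + j.*2.+1)%N by rewrite doubleS !addnS.
rewrite !addnS !addSn (qfactS _ j).
have := expr_neq1 _ j q1; rewrite exprS => nz_b.
by field; rewrite !nz_qf !expf_neq0 // q0 nz_b.
Qed.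

Theorem theorem6 (F : finFieldType) (q n k : nat)
    (hq : #|F| = q) (hn : (1 <= n)%N) (hk : (k <= n)%N) :
  #|nilpotent_mx_of_rank F n (n - k)|%:R =
    (orderGL F n)%:R / (orderGL F k)%:R *
    ((\prod_(k <= i < n) (1 - 1 / q%:R ^+ i)) /
     (q%:R ^+ (n - k) * \prod_(1 <= i < (n - k).+1) (1 - 1 / q%:R ^+ i)))
    :> rat.
Proof.
subst q; case: k hk => [|j] hk.
  (* For k = 0 both sides vanish: the rank is full, and the product starts with 1 - 1/q^0 = 0. *)
  rewrite subn0; case: n hn {hk} => // n _.
  by rewrite card_nilpotent_full_rank big_nat_recl // expr0 divr1 subrr
    mul0r mul0r mulr0.
have [r ->] : exists r, n = (j + r).+1.
  by exists (n - j.+1)%N; rewrite -addSn subnKC.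
have q1 : (1 : rat) < #|F|%:R by rewrite ltr1n card_finNzRing_gt1.
have nz_qf m := qfact_neq0 _ m q1.
have q0 : (#|F|%:R : rat) != 0 by rewrite gt_eqF // (lt_trans ltr01).
rewrite subSS addKn nilpotent_countE !orderGL_qfact -/(qfact _ r).
have -> : \prod_(j.+1 <= i < (j + r).+1) (1 - 1 / (#|F|%:R : rat) ^+ i) =
    qfact #|F|%:R (j + r) / qfact #|F|%:R j.
  apply: (mulIf (nz_qf j)); rewrite divfK // mulrC.
  by rewrite /qfact -big_cat_nat //= ltnS leq_addr.
(* This is n^2 as the exponent in [nilpotent_count] plus k^2 plus n - k. *)
have -> : ((j + r).+1 * (j + r).+1 =
    r * (r + j.*2.+1) + j.+1 * j.+1 + r)%N.
  by rewrite -addnn; ring.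
rewrite /nilpotent_count !exprD; field.
by rewrite !nz_qf !expf_neq0.
Qed.
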